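(* Suppose we have two coequalizer diagrams in $\mathrm{PROP}$: $$F(E)\underset{\rho}{\overset{\lambda}{\rightrightarrows}} F(\Sigma)\xrightarrow{\ \pi\ } P,\qquad F(E')\underset{\rho'}{\overset{\lambda'}{\rightrightarrows}} F(\Sigma')\xrightarrow{\ \pi'\ } P',$$ where $E,\Sigma,E',\Sigma'$ are signatures, together with morphisms of signatures $f\colon E\to E'$ and $g\colon\Sigma\to\Sigma'$ such that $F(g)\,\lambda=\lambda' F(f)$ and $F(g)\,\rho=\rho' F(f)$. Then there exists a unique morphism $h\colon P\to P'$ with $h\pi=\pi' F(g)$, and if $g$ is an epimorphism, then $h$ is a regular epimorphism.
   Context: A prop is a strict symmetric monoidal category whose objects are the natural numbers, with tensor product of objects given by addition; a morphism of props is a strict symmetric monoidal functor that is the identity on objects. $\mathrm{PROP}$ is the category of props. A signature is an object of $\mathrm{Set}^{\mathbb{N}\times\mathbb{N}}$ ($\mathbb{N}\times\mathbb{N}$ discrete). $F\colon \mathrm{Set}^{\mathbb{N}\times\mathbb{N}}\to\mathrm{PROP}$ is the left adjoint of the forgetful functor sending a prop $T$ to $(m,n)\mapsto\hom_T(m,n)$. A morphism is a regular epimorphism if it is the coequalizer of some parallel pair of morphisms. *)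

(* Defs.v *)
From Stdlib Require Import Arith FunctionalExtensionality PropExtensionality
  ProofIrrelevance ClassicalEpsilon.

Set Implicit Arguments.
Unset Strict Implicit.

Record category := Category {
  obj :> Type;
  hom : obj -> obj -> Type;
  idm : forall a, hom a a;
  cmp : forall a b c, hom b c -> hom a b -> hom a c;
  cmp_idl : forall a b (f : hom a b), cmp (idm b) f = f;
  cmp_idr : forall a b (f : hom a b), cmp f (idm a) = f;
  cmp_assoc : forall a b c d (f : hom a b) (g : hom b c) (h : hom c d),
    cmp h (cmp g f) = cmp (cmp h g) f }.

Arguments hom {_} _ _.
Arguments idm {_} _.
Arguments cmp {_ _ _ _} _ _.

Declare Scope category_scope.
Delimit Scope category_scope with cat.
Notation "g ∘ f" := (cmp g f) (at level 40, left associativity) : category_scope.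
Open Scope category_scope.

Record functor (C D : category) := Functor {
  fobj :> C -> D;
  fmap : forall a b, hom a b -> hom (fobj a) (fobj b);
  fmap_id : forall a, fmap (idm a) = idm (fobj a);
  fmap_cmp : forall a b c (g : hom b c) (f : hom a b),
    fmap (g ∘ f) = fmap g ∘ fmap f }.

Arguments fmap {C D} f {a b} _ : rename.

(** [F] is left adjoint to [G]. *)
Record adjunction (C D : category) (F : functor C D) (G : functor D C) :=
  Adjunction {
  transpose : forall (c : C) (d : D), hom (F c) d -> hom c (G d);
  untranspose : forall (c : C) (d : D), hom c (G d) -> hom (F c) d;
  transposeK : forall c d (u : hom (F c) d), untranspose (transpose u) = u;
  untransposeK : forall c d (u : hom c (G d)), transpose (untranspose u) = u;
  transpose_natl : forall (c c' : C) (d : D) (k : hom c' c) (u : hom (F c) d),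
    transpose (u ∘ fmap F k) = transpose u ∘ k;
  transpose_natr : forall (c : C) (d d' : D) (k : hom d d') (u : hom (F c) d),
    transpose (k ∘ u) = fmap G k ∘ transpose u }.

Definition epimorphism (C : category) (a b : C) (e : hom a b) : Prop :=
  forall (c : C) (u v : hom b c), u ∘ e = v ∘ e -> u = v.

Definition coequalizer (C : category) (a b q : C)
    (u v : hom a b) (e : hom b q) : Prop :=
  e ∘ u = e ∘ v /\
  forall (c : C) (k : hom b c), k ∘ u = k ∘ v -> exists! t : hom q c, t ∘ e = k.

Definition regular_epimorphism (C : category) (b q : C) (e : hom b q) : Prop :=
  exists (a : C) (u v : hom a b), coequalizer u v e.

Definition signature := nat -> nat -> Type.

Definition sig_hom (S S' : signature) := forall m n, S m n -> S' m n.

Definition SIGN : category.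
Proof.
refine (@Category signature sig_hom (fun S m n x => x)
  (fun S1 S2 S3 g f m n x => g m n (f m n x)) _ _ _); reflexivity.
Defined.

(** Transport along equalities of objects.  All such equalities are between
    natural numbers, so the transport does not depend on their proofs. *)
Definition cast (S : signature) (m n m' n' : nat) (em : m = m') (en : n = n')
    (x : S m n) : S m' n' :=
  match em in _ = m1, en in _ = n1 return S m1 n1 with eq_refl, eq_refl => x end.

(** The monoidal product on objects is [+], with unit [0].  As [0 + n] reduces
    to [n], the left unit law needs no transport; the right unit law, the
    associativity law and the hexagon do, because [n + 0] and [n], or
    [m + (n + p)] and [m + n + p], are equal but not convertible.  Since
    [psym_inv] makes the symmetry its own inverse, one hexagon implies the
    other. *)
Record prop := MakeProp {
  phom : signature;
  pid : forall n, phom n n;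
  pcmp : forall m n p, phom n p -> phom m n -> phom m p;
  ptens : forall m n m' n', phom m n -> phom m' n' -> phom (m + m') (n + n');
  psym : forall m n, phom (m + n) (n + m);
  pcmp_idl : forall m n (f : phom m n), pcmp (pid n) f = f;
  pcmp_idr : forall m n (f : phom m n), pcmp f (pid m) = f;
  pcmp_assoc : forall m n p q (f : phom m n) (g : phom n p) (h : phom p q),
    pcmp h (pcmp g f) = pcmp (pcmp h g) f;
  ptens_id : forall m n, ptens (pid m) (pid n) = pid (m + n);
  ptens_cmp : forall m n p m' n' p' (f : phom m n) (g : phom n p)
      (f' : phom m' n') (g' : phom n' p'),
    ptens (pcmp g f) (pcmp g' f') = pcmp (ptens g g') (ptens f f');
  ptens_unitl : forall m n (f : phom m n), ptens (pid 0) f = f;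
  ptens_unitr : forall m n (f : phom m n),
    cast (Nat.add_0_r m) (Nat.add_0_r n) (ptens f (pid 0)) = f;
  ptens_assoc : forall m n m' n' m'' n''
      (f : phom m n) (g : phom m' n') (h : phom m'' n''),
    cast (Nat.add_assoc m m' m'') (Nat.add_assoc n n' n'')
      (ptens f (ptens g h)) = ptens (ptens f g) h;
  psym_nat : forall m n m' n' (f : phom m n) (g : phom m' n'),
    pcmp (psym n n') (ptens f g) = pcmp (ptens g f) (psym m m');
  psym_inv : forall m n, pcmp (psym n m) (psym m n) = pid (m + n);
  psym_unit : forall n, cast eq_refl (Nat.add_0_r n) (psym 0 n) = pid n;
  psym_hexagon : forall m n p,
    psym m (n + p) =
      cast (eq_sym (Nat.add_assoc m n p)) (Nat.add_assoc n p m)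
        (pcmp (ptens (pid n) (psym m p))
              (cast eq_refl (eq_sym (Nat.add_assoc n m p))
                (ptens (psym m n) (pid p)))) }.

Arguments pid : clear implicits.
Arguments psym : clear implicits.

Record prop_hom (T T' : prop) := PropHom {
  pmap :> forall m n, phom T m n -> phom T' m n;
  pmap_id : forall n, pmap (pid T n) = pid T' n;
  pmap_cmp : forall m n p (g : phom T n p) (f : phom T m n),
    pmap (pcmp g f) = pcmp (pmap g) (pmap f);
  pmap_tens : forall m n m' n' (f : phom T m n) (g : phom T m' n'),
    pmap (ptens f g) = ptens (pmap f) (pmap g);
  pmap_sym : forall m n, pmap (psym T m n) = psym T' m n }.

Arguments pmap {T T'} _ {m n} _.

Lemma prop_hom_ext (T T' : prop) (u v : prop_hom T T') :
  (forall m n (x : phom T m n), u m n x = v m n x) -> u = v.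
Proof.
destruct u as [u u1 u2 u3 u4], v as [v v1 v2 v3 v4]; simpl; intros uv.
assert (e : u = v) by (repeat (apply functional_extensionality_dep; intro); apply uv).
subst v; f_equal; apply proof_irrelevance.
Qed.

Definition prop_hom_id (T : prop) : prop_hom T T.
Proof. refine (@PropHom T T (fun m n x => x) _ _ _ _); reflexivity. Defined.

Definition prop_hom_cmp (T1 T2 T3 : prop) (v : prop_hom T2 T3)
    (u : prop_hom T1 T2) : prop_hom T1 T3.
Proof.
refine (@PropHom T1 T3 (fun m n x => pmap v (pmap u x)) _ _ _ _); intros.
- now rewrite !pmap_id.
- now rewrite !pmap_cmp.
- now rewrite !pmap_tens.
- now rewrite !pmap_sym.
Defined.

Definition PROP : category.
Proof.
refine (@Category prop prop_hom prop_hom_id prop_hom_cmp _ _ _);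
  intros; apply prop_hom_ext; reflexivity.
Defined.

Definition forget : functor PROP SIGN.
Proof.
refine (@Functor PROP SIGN phom (fun T T' (u : prop_hom T T') m n x => pmap u x) _ _);
  reflexivity.
Defined.

(** A left adjoint of [forget] exists.  The free prop is the quotient of the prop terms over a signature by the
    equations that hold under every valuation in every prop. *)

Inductive term (S : signature) : nat -> nat -> Type :=
| t_gen m n : S m n -> term S m n
| t_id n : term S n n
| t_cmp m n p : term S n p -> term S m n -> term S m p
| t_tens m n m' n' : term S m n -> term S m' n' -> term S (m + m') (n + n')
| t_sym m n : term S (m + n) (n + m).

Arguments t_id S n : clear implicits.
Arguments t_sym S m n : clear implicits.

Fixpoint eval (S : signature) (T : prop) (v : sig_hom S (phom T)) m n
    (t : term S m n) : phom T m n :=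
  match t with
  | t_gen x => v _ _ x
  | t_id _ n => pid T n
  | t_cmp t u => pcmp (eval v t) (eval v u)
  | t_tens t u => ptens (eval v t) (eval v u)
  | t_sym _ m n => psym T m n
  end.

Definition teq (S : signature) m n (t u : term S m n) : Prop :=
  forall (T : prop) (v : sig_hom S (phom T)), eval v t = eval v u.

Definition fhom (S : signature) : signature := fun m n =>
  { c : term S m n -> Prop | exists t, c = teq t }.

Definition cls (S : signature) m n (t : term S m n) : fhom S m n :=
  exist _ (teq t) (ex_intro _ t eq_refl).

Definition rep (S : signature) m n (x : fhom S m n) : term S m n :=
  proj1_sig (constructive_indefinite_description _ (proj2_sig x)).

Lemma cls_rep S m n (x : fhom S m n) : cls (rep x) = x.
Proof.
unfold rep, cls; destruct constructive_indefinite_description as [t e]; simpl.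
destruct x as [c p]; simpl in *; subst c; f_equal; apply proof_irrelevance.
Qed.

Lemma cls_eq S m n (t u : term S m n) : teq t u -> cls t = cls u.
Proof.
intros tu; assert (e : teq t = teq u).
{ apply functional_extensionality; intros w; apply propositional_extensionality.
  split; intros h T v; [rewrite <- (tu T v) | rewrite (tu T v)]; apply h. }
unfold cls; generalize (ex_intro (fun t0 => teq t = teq t0) t eq_refl).
rewrite e; intros p; f_equal; apply proof_irrelevance.
Qed.

Definition ev (S : signature) (T : prop) (v : sig_hom S (phom T)) m n
    (x : fhom S m n) : phom T m n := eval v (rep x).

Lemma ev_cls S T (v : sig_hom S (phom T)) m n (t : term S m n) :
  ev v (cls t) = eval v t.
Proof.
unfold ev, rep; destruct constructive_indefinite_description as [u e]; simpl in *.
assert (h : teq t u) by (rewrite e; intros ? ?; reflexivity).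
symmetry; apply h.
Qed.

Lemma fhom_ext S m n (x y : fhom S m n) :
  (forall (T : prop) (v : sig_hom S (phom T)), ev v x = ev v y) -> x = y.
Proof. intros h; rewrite <- (cls_rep x), <- (cls_rep y); apply cls_eq; exact h. Qed.

Lemma ev_cast S T (v : sig_hom S (phom T)) m n m' n' (em : m = m') (en : n = n')
    (x : fhom S m n) : ev v (cast em en x) = cast em en (ev v x).
Proof. destruct em, en; reflexivity. Qed.

Definition fid (S : signature) n : fhom S n n := cls (t_id S n).
Definition fcmp (S : signature) m n p (g : fhom S n p) (f : fhom S m n) :
  fhom S m p := cls (t_cmp (rep g) (rep f)).
Definition ftens (S : signature) m n m' n' (f : fhom S m n) (g : fhom S m' n') :
  fhom S (m + m') (n + n') := cls (t_tens (rep f) (rep g)).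
Definition fsym (S : signature) m n : fhom S (m + n) (n + m) := cls (t_sym S m n).

Lemma ev_id S T (v : sig_hom S (phom T)) n : ev v (fid S n) = pid T n.
Proof. apply ev_cls. Qed.

Lemma ev_cmp S T (v : sig_hom S (phom T)) m n p (g : fhom S n p) (f : fhom S m n) :
  ev v (fcmp g f) = pcmp (ev v g) (ev v f).
Proof. apply ev_cls. Qed.

Lemma ev_tens S T (v : sig_hom S (phom T)) m n m' n'
    (f : fhom S m n) (g : fhom S m' n') :
  ev v (ftens f g) = ptens (ev v f) (ev v g).
Proof. apply ev_cls. Qed.

Lemma ev_sym S T (v : sig_hom S (phom T)) m n : ev v (fsym S m n) = psym T m n.
Proof. apply ev_cls. Qed.

Lemma cls_cmp S m n p (g : term S n p) (f : term S m n) :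
  cls (t_cmp g f) = fcmp (cls g) (cls f).
Proof. apply fhom_ext; intros T v; now rewrite ev_cmp, !ev_cls. Qed.

Lemma cls_tens S m n m' n' (f : term S m n) (g : term S m' n') :
  cls (t_tens f g) = ftens (cls f) (cls g).
Proof. apply fhom_ext; intros T v; now rewrite ev_tens, !ev_cls. Qed.

Definition free_prop (S : signature) : prop.
Proof.
refine (@MakeProp (fhom S) (@fid S) (@fcmp S) (@ftens S) (@fsym S)
  _ _ _ _ _ _ _ _ _ _ _ _);
intros; apply fhom_ext; intros T v;
repeat rewrite ?ev_cast, ?ev_id, ?ev_cmp, ?ev_tens, ?ev_sym.
- apply pcmp_idl.
- apply pcmp_idr.
- apply pcmp_assoc.
- apply ptens_id.
- apply ptens_cmp.
- apply ptens_unitl.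
- apply ptens_unitr.
- apply ptens_assoc.
- apply psym_nat.
- apply psym_inv.
- apply psym_unit.
- apply psym_hexagon.
Defined.

Definition free_unit (S : signature) : sig_hom S (phom (free_prop S)) :=
  fun m n x => cls (t_gen x).

Definition free_lift (S : signature) (T : prop) (v : sig_hom S (phom T)) :
  prop_hom (free_prop S) T.
Proof.
refine (@PropHom (free_prop S) T (fun m n x => ev v x) _ _ _ _);
  intros; apply ev_cls.
Defined.

Lemma free_eval (S : signature) (T : prop) (u : prop_hom (free_prop S) T)
    m n (t : term S m n) :
  pmap u (cls t) = eval (fun m n x => pmap u (free_unit x)) t.
Proof.
induction t as [m n x|n|m n p t IHt t' IHt'|m n m' n' t IHt t' IHt'|m n]; simpl.
- reflexivity.
- apply (pmap_id u).
- rewrite <- IHt, <- IHt', cls_cmp; apply (pmap_cmp u).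
- rewrite <- IHt, <- IHt', cls_tens; apply (pmap_tens u).
- apply (pmap_sym u).
Qed.

Lemma free_liftP S T (v : sig_hom S (phom T)) m n (x : S m n) :
  pmap (free_lift v) (free_unit x) = v m n x.
Proof. apply (ev_cls v (t_gen x)). Qed.

Lemma free_hom_ext S T (u w : prop_hom (free_prop S) T) :
  (forall m n (x : S m n), pmap u (free_unit x) = pmap w (free_unit x)) -> u = w.
Proof.
intros uw; apply prop_hom_ext; intros m n x.
rewrite <- (cls_rep x), !free_eval; f_equal.
repeat (apply functional_extensionality_dep; intro); apply uw.
Qed.

Definition free : functor SIGN PROP.
Proof.
refine (@Functor SIGN PROP free_prop
  (fun S S' (g : sig_hom S S') => free_lift (fun m n x => free_unit (g m n x))) _ _).
- intros S; apply free_hom_ext; intros m n x.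
  rewrite free_liftP; reflexivity.
- intros S1 S2 S3 g f; apply free_hom_ext; intros m n x.
  change (pmap (free_lift (fun m n y => free_unit (g m n (f m n y)))) (free_unit x) =
    pmap (free_lift (fun m n y => free_unit (g m n y)))
      (pmap (free_lift (fun m n y => free_unit (f m n y))) (free_unit x))).
  rewrite !free_liftP; reflexivity.
Defined.

Definition free_adjunction : adjunction free forget.
Proof.
refine (@Adjunction SIGN PROP free forget
  (fun S T (u : prop_hom (free_prop S) T) m n x => pmap u (free_unit x))
  (fun S T v => free_lift v) _ _ _ _).
- intros S T u; apply free_hom_ext; intros; apply free_liftP.
- intros S T v; repeat (apply functional_extensionality_dep; intro); apply free_liftP.
- intros S S' T k u; apply functional_extensionality_dep; intros m.
  apply functional_extensionality_dep; intros n.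
  apply functional_extensionality_dep; intros x.
  change (pmap u (pmap (free_lift (fun m n y => free_unit (k m n y))) (free_unit x))
      = pmap u (free_unit (k m n x))).
  rewrite free_liftP; reflexivity.
- reflexivity.
Defined.

(* Main.v *)
Require Import Defs.
From Stdlib Require Import FunctionalExtensionality PropExtensionality
  ClassicalEpsilon.

(** The induced morphism [h] comes from the universal property of [pi], since
    [pi' ∘ fmap F g] coequalizes [lambda] and [rho].

    Suppose that [g] is an epimorphism.  Signatures are families of sets, so [g]
    is surjective in each degree and, by choice, has a section; therefore
    [fmap F g] has one too ([sig_epi_section]).  A coequalizer preceded by a
    split epimorphism is again a coequalizer: one pair makes a morphism
    factor through the split epimorphism, another one makes the factorization
    factor through the given coequalizer, and the two pairs are merged into one on a coproduct
    of their domains ([coequalizer_after_split]).  That coproduct is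
    [F (E' + Sigma)], because left adjoints preserve coproducts
    ([left_adjoint_coproduct]).  Hence [h ∘ pi = pi' ∘ fmap F g] is a regular
    epimorphism, and cancelling the epimorphism [pi] leaves [h] regular
    ([regular_epi_cancel]). *)

Lemma coequalizer_epi {C : category} {a b q : C} {u v : hom a b} {e : hom b q} :
  coequalizer u v e -> epimorphism e.
Proof.
intros [e_uv univ] c k l kl.
destruct (univ c (k ∘ e)) as [t [_ t_unique]].
{ now rewrite <- !cmp_assoc, e_uv. }
now transitivity t; [symmetry|]; apply t_unique.
Qed.

(** If [h ∘ e] is the coequalizer of a pair, then [h] is the coequalizer of the
    image of that pair under [e]. *)
Lemma regular_epi_cancel {C : category} {a b c : C} (e : hom a b) (h : hom b c) :
  epimorphism e -> regular_epimorphism (h ∘ e) -> regular_epimorphism h.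
Proof.
intros e_epi (r & u & v & he_uv & univ).
exists r, (e ∘ u), (e ∘ v); split.
{ now rewrite !cmp_assoc. }
intros d k k_uv; destruct (univ d (k ∘ e)) as [t [te t_unique]].
{ now rewrite <- !cmp_assoc. }
exists t; split.
- apply e_epi; now rewrite <- cmp_assoc.
- intros t' t'h; apply t_unique; now rewrite cmp_assoc, t'h.
Qed.

Definition coproduct {C : category} {a b s : C} (i : hom a s) (j : hom b s) : Prop :=
  forall (c : C) (u : hom a c) (v : hom b c),
    exists! w : hom s c, w ∘ i = u /\ w ∘ j = v.

Lemma coproduct_ext {C : category} {a b s : C} {i : hom a s} {j : hom b s} :
  coproduct i j -> forall (c : C) (u v : hom s c),
  u ∘ i = v ∘ i -> u ∘ j = v ∘ j -> u = v.
Proof.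
intros sum c u v ui uj; destruct (sum c (v ∘ i) (v ∘ j)) as [w [_ w_unique]].
now transitivity w; [symmetry|]; apply w_unique.
Qed.

(** The relations are [s ∘ u ~ s ∘ v], which lift those of [p] to [d], and
    [s ∘ r ~ idm d], which makes a morphism out of [d] factor through [r]. *)
Lemma coequalizer_after_split {C : category} {a b d q w : C}
    {u v : hom a b} {p : hom b q} {r : hom d b} {s : hom b d}
    {i : hom a w} {j : hom d w} :
  coequalizer u v p -> r ∘ s = idm b -> coproduct i j ->
  regular_epimorphism (p ∘ r).
Proof.
intros p_coeq rs sum; pose proof (coequalizer_epi p_coeq) as p_epi.
destruct p_coeq as [p_uv univ].
destruct (sum d (s ∘ u) (s ∘ r)) as [x [[xi xj] _]].
destruct (sum d (s ∘ v) (idm d)) as [y [[yi yj] _]].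
exists w, x, y; split.
- apply (coproduct_ext sum); rewrite <- !(cmp_assoc _ _ (p ∘ r)).
  + rewrite xi, yi, <- !cmp_assoc, !(cmp_assoc _ _ r), rs, !cmp_idl; exact p_uv.
  + rewrite xj, yj, cmp_idr, <- !cmp_assoc, (cmp_assoc _ _ r), rs, cmp_idl.
    reflexivity.
- intros c k k_xy.
  assert (k_uv : k ∘ s ∘ u = k ∘ s ∘ v).
  { now rewrite <- !cmp_assoc, <- xi, <- yi, !cmp_assoc, k_xy. }
  assert (k_sr : k ∘ s ∘ r = k).
  { now rewrite <- cmp_assoc, <- xj, cmp_assoc, k_xy, <- cmp_assoc, yj, cmp_idr. }
  destruct (univ c (k ∘ s) k_uv) as [t [tp t_unique]]; exists t; split.
  + now rewrite cmp_assoc, tp.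
  + intros t' t'pr; apply t_unique.
    now rewrite <- t'pr, <- !cmp_assoc, rs, cmp_idr.
Qed.

Lemma left_adjoint_coproduct {C D : category} {F : functor C D} {G : functor D C}
    (adj : adjunction F G) {a b s : C} (i : hom a s) (j : hom b s) :
  coproduct i j -> coproduct (fmap F i) (fmap F j).
Proof.
intros sum d u v.
destruct (sum (G d) (transpose adj u) (transpose adj v)) as [w [[wi wj] w_unique]].
exists (untranspose adj w); split.
- split; rewrite <- (transposeK adj (untranspose adj w ∘ _)), transpose_natl,
    untransposeK; [rewrite wi | rewrite wj]; apply transposeK.
- intros w' [w'i w'j]; rewrite <- (transposeK adj w'); f_equal; apply w_unique.
  now rewrite <- !transpose_natl, w'i, w'j.
Qed.

Definition sig_sum (S S' : signature) : signature :=
  fun m n => (S m n + S' m n)%type.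

Definition sig_inl (S S' : signature) : sig_hom S (sig_sum S S') :=
  fun m n x => inl x.

Definition sig_inr (S S' : signature) : sig_hom S' (sig_sum S S') :=
  fun m n x => inr x.

Lemma sig_sum_coproduct (S S' : signature) :
  @coproduct SIGN S S' (sig_sum S S') (sig_inl S S') (sig_inr S S').
Proof.
intros T u v.
exists (fun m n x => match x with inl y => u m n y | inr z => v m n z end); split.
{ split; reflexivity. }
intros w [wl wr]; subst u v.
repeat (apply functional_extensionality_dep; intro).
match goal with |- _ = w _ _ ?x => now destruct x end.
Qed.

(** Surjectivity is detected by two maps to the signature of truth values: the
    constant one and the characteristic map of the image of [g], which agree
    along [g]. *)
Lemma sig_epi_section {S S' : SIGN} (g : hom S S') :
  epimorphism g -> exists s : hom S' S, g ∘ s = idm S'.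
Proof.
intros g_epi.
assert (surj : forall m n (y : S' m n), exists x : S m n, g m n x = y).
{ intros m n y.
  pose (truth := (fun _ _ => Prop) : signature).
  pose (all := (fun m n _ => True) : sig_hom S' truth).
  pose (image := (fun m n y => exists x : S m n, g m n x = y) : sig_hom S' truth).
  assert (e : all = image).
  { apply (g_epi truth all image).
    repeat (apply functional_extensionality_dep; intro).
    apply propositional_extensionality; split; [|exact (fun _ => I)].
    intros _; eexists; reflexivity. }
  change (image m n y); rewrite <- e; exact I. }
exists (fun m n y => proj1_sig (constructive_indefinite_description _ (surj m n y))).
apply functional_extensionality_dep; intros m.
apply functional_extensionality_dep; intros n.
apply functional_extensionality_dep; intros y.
exact (proj2_sig (constructive_indefinite_description _ (surj m n y))).
Qed.

Theorem proposition2p3p7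
  (F : functor SIGN PROP) (adj : adjunction F forget)
  (E Sigma E' Sigma' : SIGN) (P P' : PROP)
  (lambda rho : hom (F E) (F Sigma)) (pi : hom (F Sigma) P)
  (lambda' rho' : hom (F E') (F Sigma')) (pi' : hom (F Sigma') P')
  (Hpi : coequalizer lambda rho pi) (Hpi' : coequalizer lambda' rho' pi')
  (f : hom E E') (g : hom Sigma Sigma')
  (Hlambda : fmap F g ∘ lambda = lambda' ∘ fmap F f)
  (Hrho : fmap F g ∘ rho = rho' ∘ fmap F f) :
  exists h : hom P P',
    unique (fun k : hom P P' => k ∘ pi = pi' ∘ fmap F g) h /\
    (epimorphism g -> regular_epimorphism h).
Proof.
destruct (proj2 Hpi P' (pi' ∘ fmap F g)) as [h [h_pi h_unique]].
{ rewrite <- !cmp_assoc, Hlambda, Hrho, !cmp_assoc; now rewrite (proj1 Hpi'). }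
exists h; split; [now split|]; intros g_epi.
destruct (sig_epi_section g g_epi) as [s gs].
apply (regular_epi_cancel pi); [exact (coequalizer_epi Hpi)|]; rewrite h_pi.
eapply (coequalizer_after_split (s := fmap F s) Hpi').
- now rewrite <- fmap_cmp, gs, fmap_id.
- exact (left_adjoint_coproduct adj _ _ (sig_sum_coproduct E' Sigma)).
Qed.
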